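(* Let $X$ be a (real or complex) Banach space and let $\tilde\alpha$ be a real number with $\alpha(X^* )>\tilde\alpha>0$. Then $$\Phi^S_X(\delta)\leq\sqrt{2\delta}\,\sqrt{1-\tfrac13\tilde\alpha}\qquad\text{for } \delta\in\left(0,\tfrac12-\tfrac16\tilde\alpha\right)$$ and $$\Phi^S_X(\delta)\leq 2\delta\qquad\text{for } \delta\in\left(\tfrac12-\tfrac16\tilde\alpha,\tfrac12\right).$$ Consequently (since $\alpha(X)=\alpha(X^* )$ for every Banach space $X$), one has $$\Phi^S_X(\delta)\leq\sqrt{2\delta}\,\sqrt{1-\tfrac13\alpha(X)}\qquad\text{for } \delta\in\left(0,\tfrac12-\tfrac16\alpha(X)\right)$$ and $$\Phi^S_X(\delta)\leq 2\delta\qquad\text{for } \delta\in\left(\tfrac12-\tfrac16\alpha(X),\tfrac12\right).$$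
   Context: For a Banach space $X$ with dual $X^*$, $B_X$ and $S_X$ denote the closed unit ball and the unit sphere. The parameter of uniform non-squareness of $X$ is $$\alpha(X):=2-\sup_{x,y\in B_X}\left\{\tfrac12\big(\|x+y\|+\|x-y\|\big)\right\}.$$ Let $\Pi(X):=\{(x,x^* )\in X\times X^* : \|x\|=\|x^*\|=x^*(x)=1\}$. The spherical Bishop-Phelps-Bollobás modulus of $X$ is the function $\Phi_X^S$ on $(0,2)$ such that, for $\delta\in(0,2)$, $\Phi^S_X(\delta)$ is the infimum of those $\varepsilon>0$ satisfying that for every $(x,x^* )\in S_X\times S_{X^*}$ with $\operatorname{Re}x^*(x)>1-\delta$ there is $(y,y^* )\in\Pi(X)$ with $\|x-y\|<\varepsilon$ and $\|x^*-y^*\|<\varepsilon$. *)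

(* Defs.v *)
From HB Require Import structures.
From mathcomp Require Import all_boot all_order all_algebra.
From mathcomp Require Import all_classical all_reals all_analysis.
From mathcomp Require Import complex.

Set Implicit Arguments.
Unset Strict Implicit.
Unset Printing Implicit Defensive.

Import Order.TTheory GRing.Theory Num.Theory.
Import numFieldNormedType.Exports.

Local Open Scope classical_set_scope.
Local Open Scope ring_scope.

Variant scalars := RealScalars | ComplexScalars.

Definition scalar_field (R : realType) (s : scalars) : numFieldType :=
  match s with RealScalars => R | ComplexScalars => R[i] end.

Definition re (R : realType) (s : scalars) : scalar_field R s -> R :=
  match s return scalar_field R s -> R with
  | RealScalars => id
  | ComplexScalars => @complex.Re R
  end.

Definition of_real (R : realType) (s : scalars) : R -> scalar_field R s :=
  match s return R -> scalar_field R s with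
  | RealScalars => id
  | ComplexScalars => fun x => x%:C%C
  end.

(* Over [R[i]] the library norm [`|x|] is a complex number with zero imaginary
   part; [rnorm x] is the same number, in [R]. *)
Definition rnorm (R : realType) (s : scalars)
    (V : normedZmodType (scalar_field R s)) (x : V) : R :=
  re `|x|.

Definition closed_unit_ball (R : realType) (s : scalars)
    (V : normedModType (scalar_field R s)) : set V :=
  [set x | rnorm x <= 1].
Arguments closed_unit_ball {R s} V.

Definition unit_sphere (R : realType) (s : scalars)
    (V : normedModType (scalar_field R s)) : set V :=
  [set x | rnorm x = 1].
Arguments unit_sphere {R s} V.

Definition alpha (R : realType) (s : scalars)
    (V : normedModType (scalar_field R s)) : R :=
  2 - sup [set 2^-1 * (rnorm (x + y) + rnorm (x - y)) |
            x in closed_unit_ball V & y in closed_unit_ball V].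

Section scalars_theory.
Variables (R : realType) (s : scalars).
Local Notation K := (scalar_field R s).

Lemma of_realK : cancel (@of_real R s) (@re R s).
Proof. by case: s. Qed.

Lemma of_realD (a b : R) : of_real s (a + b) = of_real s a + of_real s b.
Proof. by case: s => //=; rewrite raddfD. Qed.

Lemma of_realM (a b : R) : of_real s (a * b) = of_real s a * of_real s b.
Proof. by case: s => //=; rewrite rmorphM. Qed.

Lemma ler_of_real (a b : R) : (of_real s a <= of_real s b) = (a <= b).
Proof. by case: s => //=; rewrite lecR. Qed.

Lemma re_normK (V : normedZmodType K) (x : V) : of_real s (rnorm x) = `|x|.
Proof.
rewrite /rnorm; have := normr_ge0 x; move: `|x|.
by case: s => //= z /ger0_real /RRe_real.
Qed.

Lemma re_mono (x y : K) : x \is Num.real -> y \is Num.real ->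
  (re x <= re y) = (x <= y).
Proof.
case: s x y => //= x y xr yr.
by rewrite -(RRe_real xr) -(RRe_real yr) lecR.
Qed.

Variable V : normedModType K.

Lemma rnorm_ge0 (x : V) : 0 <= rnorm x.
Proof.
have := normr_ge0 x; rewrite -re_normK.
have -> : (0 : K) = of_real s 0 by case: s.
by rewrite ler_of_real.
Qed.

Lemma rnorm0 : rnorm (0 : V) = 0.
Proof. by rewrite /rnorm normr0; case: s. Qed.

Lemma ler_rnormD (x y : V) : rnorm (x + y) <= rnorm x + rnorm y.
Proof. by rewrite -ler_of_real of_realD !re_normK ler_normD. Qed.

End scalars_theory.

Section dual.
Variables (R : realType) (s : scalars) (X : normedModType (scalar_field R s)).
Local Notation K := (scalar_field R s).

Definition continuous_linear : {pred X -> K^o} :=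
  [pred f | `[< linear f /\ continuous f >]].

Record dual := Dual {
  dual_fun :> X -> K^o ;
  _ : dual_fun \in continuous_linear }.

HB.instance Definition _ := [isSub for dual_fun].
HB.instance Definition _ := [Choice of dual by <:].

Lemma dual_linear (f : dual) : linear f.
Proof. by case: f => f /= /asboolP[]. Qed.

Lemma dual_continuous (f : dual) : continuous f.
Proof. by case: f => f /= /asboolP[]. Qed.

HB.instance Definition _ (f : dual) :=
  GRing.isLinear.Build K X K^o *:%R f (@dual_linear f).

Lemma continuous_linear_submod_closed : submod_closed continuous_linear.
Proof.
split.
  apply/asboolP; split; last by move=> x; exact: cvg_cst.
  by move=> a x y; rewrite /= /GRing.zero/= scaler0 addr0.
move=> a f g /asboolP[lf cf] /asboolP[lg cg]; apply/asboolP; split.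
  move=> b x y.
  rewrite -![(_ + g) _]/(a *: f _ + g _) lf lg !scalerDr !scalerA mulrC.
  by rewrite -!addrA; congr (_ + _); rewrite addrCA.
move=> x; rewrite /continuous_at.
have -> : a *: f + g = (fun y => a *: f y + g y) by [].
apply: (@cvgD _ K^o _ (nbhs x) _ (fun y => a *: f y) g); last exact: cg.
by apply: (@cvgZl_tmp K K^o); exact: cf.
Qed.

HB.instance Definition _ := GRing.isSubmodClosed.Build K (X -> K^o)
  continuous_linear continuous_linear_submod_closed.
HB.instance Definition _ := [SubChoice_isSubLmodule of dual by <:].

Definition dual_rnorm (f : dual) : R :=
  sup [set rnorm (f x) | x in closed_unit_ball X].

Lemma dual_rnorm_has_sup (f : dual) :
  has_sup [set rnorm (f x) | x in closed_unit_ball X].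
Proof.
split.
  by exists (rnorm (f 0)), 0 => //; rewrite /closed_unit_ball/= rnorm0.
have /linear_bounded_continuous := @dual_continuous f.
move=> /linear_boundedP /pinfty_ex_gt0 [M M0 fM].
exists (re M) => _ [x x1 <-]; rewrite /rnorm re_mono ?normr_real ?gtr0_real//.
apply: (le_trans (fM x)); rewrite ger_pMr// -re_normK.
have -> : (1 : K) = of_real s 1 by case: s.
by rewrite ler_of_real.
Qed.

(* The norm of the library takes its values in the scalar field. *)
Definition dual_norm (f : dual) : K := of_real s (dual_rnorm f).

Lemma dual_rnorm_ub (f : dual) (x : X) :
  rnorm x <= 1 -> rnorm (f x) <= dual_rnorm f.
Proof.
by move=> x1; apply: ub_le_sup; [case: (dual_rnorm_has_sup f)|exists x].
Qed.

Lemma dual_rnorm_le (f : dual) (M : R) :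
  (forall x : X, rnorm x <= 1 -> rnorm (f x) <= M) -> dual_rnorm f <= M.
Proof.
move=> fM; apply: ge_sup; first by case: (dual_rnorm_has_sup f).
by move=> _ [x x1 <-]; exact: fM.
Qed.

Lemma ler_dual_normD (f g : dual) :
  dual_norm (f + g) <= dual_norm f + dual_norm g.
Proof.
rewrite -of_realD ler_of_real; apply: dual_rnorm_le => x x1.
apply: le_trans (ler_rnormD (f x) (g x)) _.
by apply: lerD; exact: dual_rnorm_ub.
Qed.

Lemma rnormZ (V : normedModType K) (a : K) (x : V) :
  rnorm (a *: x) = rnorm (a : K^o) * rnorm x.
Proof.
by apply: (can_inj (@of_realK R s)); rewrite of_realM !re_normK normrZ.
Qed.

Lemma dual_rnormZ_le (a : K) (f : dual) :
  dual_rnorm (a *: f) <= rnorm (a : K^o) * dual_rnorm f.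
Proof.
apply: dual_rnorm_le => x x1; rewrite -[(a *: f) x]/(a *: (f x : K^o)) rnormZ.
by apply: ler_wpM2l; [exact: (@rnorm_ge0 _ _ K^o)|exact: dual_rnorm_ub].
Qed.

Lemma dual_normZ (a : K) (f : dual) : dual_norm (a *: f) = `|a| * dual_norm f.
Proof.
rewrite -[`|a|](@re_normK R s K^o) -of_realM; congr of_real.
apply/eqP; rewrite eq_le dual_rnormZ_le/=.
have [->|a0] := eqVneq a 0.
  rewrite (@rnorm0 R s K^o) mul0r; apply: le_trans (dual_rnorm_ub _ (x := 0) _).
    exact: (@rnorm_ge0 _ _ K^o).
  by rewrite rnorm0.
have := dual_rnormZ_le a^-1 (a *: f); rewrite scalerA mulVf// scale1r => H.
apply: le_trans (ler_wpM2l (@rnorm_ge0 _ _ K^o a) H) _.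
rewrite mulrA -[_ * rnorm _](@rnormZ K^o) -[_ *: _]/(a * _) mulfV//.
by rewrite /rnorm normr1 [re _](_ : _ = 1) ?mul1r//; case: s.
Qed.

Lemma dual_norm0_eq0 (f : dual) : dual_norm f = 0 -> f = 0.
Proof.
have -> : (0 : K) = of_real s 0 by case: s.
move=> /(can_inj (@of_realK R s)) f0.
apply/val_inj/funext => x; change (f x = 0).
have [->|x0] := eqVneq x 0; first exact: linear0.
have h : rnorm (f (`|x|^-1 *: x)) <= 0.
  rewrite -f0; apply: dual_rnorm_ub; rewrite /rnorm normrZ normfV normr_id.
  by rewrite mulVf ?normr_eq0// ; case: s.
have {h} : f (`|x|^-1 *: x) = 0.
  apply/normr0_eq0; rewrite -(@re_normK R s K^o).
  have -> : rnorm (f (`|x|^-1 *: x) : K^o) = 0.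
    by apply/eqP; rewrite eq_le h; exact: (@rnorm_ge0 _ _ K^o).
  by case: s.
rewrite linearZ/= => /eqP; rewrite mulf_eq0 invr_eq0 normr_eq0 (negbTE x0)/=.
by move/eqP.
Qed.

HB.instance Definition _ := Lmodule_isNormed.Build K dual
  ler_dual_normD dual_normZ dual_norm0_eq0.

End dual.

Definition Pi (R : realType) (s : scalars)
    (X : normedModType (scalar_field R s)) : set (X * dual X) :=
  [set p : X * dual X | [/\ rnorm p.1 = 1, rnorm p.2 = 1 & p.2 p.1 = 1]].
Arguments Pi {R s} X.

(* The infimum is taken in the extended reals, so that the modulus would be
   [+oo] (and not the default value 0) if no [e] were admissible. *)
Definition Phi_S (R : realType) (s : scalars)
    (X : normedModType (scalar_field R s)) (d : R) : \bar R :=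
  ereal_inf [set e%:E | e in [set e : R | 0 < e /\
    forall (x : X) (f : dual X),
      unit_sphere X x -> unit_sphere (dual X) f -> re (f x) > 1 - d ->
      exists (y : X) (g : dual X),
        [/\ Pi X (y, g), rnorm (x - y) < e & rnorm (f - g) < e]]].

(* Main.v *)
From HB Require Import structures.
Require Import Defs.
From mathcomp Require Import all_boot all_order all_algebra.
From mathcomp Require Import all_classical all_reals all_analysis.
From mathcomp Require Import complex ring lra.
Import Order.TTheory GRing.Theory Num.Theory.
Import numFieldNormedType.Exports.
Local Open Scope ring_scope.

Set Implicit Arguments.
Unset Strict Implicit.
Unset Printing Implicit Defensive.
Local Open Scope classical_set_scope.

(** Given a unit vector [x] and a unit functional [f] with [re (f x) > 1 - d],
    fix [0 < k <= 1/2].  Ekeland's principle on the unit ball, followed by a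
    Hahn-Banach separation ([bishop_phelps]), trades accuracy in [x] against
    accuracy in [f]: it yields a functional [g] attaining its norm at a point
    [y] of the ball with [|x - y| <= d / k] and [|f - g| <= k].  Since
    [|g| >= 1 - k > 0], the point [y] has norm one and [h = g / |g|] satisfies
    [(y, h) \in Pi X].

    The naive estimate [|f - h| <= |f - g| + | |g| - 1 | <= 2 k] is nearly
    attained only if two triangle inequalities are nearly equalities at once,
    one making [|u + v|] nearly 2 and the other making [|u - v|] nearly 2, for
    the same two vectors [u], [v] of the dual ball.  A parameter [a] with
    [0 <= a <= alpha (dual X)] bounds [|u + v| + |u - v|] by [2 (2 - a)], so
    both cannot happen.  Quantitatively this gives
    [|f - h| <= (1 + (1 - a)^2) k <= (2 - 2 a / 3) k]
    ([dist_normalized_le]).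

    Hence [Phi_S X d <= max (d / k) ((2 - 2 a / 3) k)] for every [k <= 1/2].
    The two terms are equal when [k^2 = d / (2 - 2 a / 3)], which is allowed
    exactly for [d <= 1/2 - a / 6] and gives the square-root bound; for larger
    [d] the choice [k = 1/2] makes the first term, [2 d], the larger one.
    The estimates hold for [a = alpha (dual X)] too, and
    [alpha X <= alpha (dual X)], so that [a = alpha X] is admissible.

    Separation is obtained without subspaces: by Zorn's lemma there is a
    minimal sublinear functional below a given one, and minimality forces it to
    be real-linear.  Complex functionals are recovered from their real parts. *)

(** * Sublinear functionals and the Hahn-Banach theorem *)

Section sublinear.
Variables (R : realType) (s : scalars) (V : lmodType (scalar_field R s)).
Implicit Types (p q : V -> R) (x y c w : V).
Local Notation "t *_R x" := (of_real s t *: x) (at level 40).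

(** Only scalings by positive reals occur, so that the same notion serves real
    and complex spaces; equality in the second clause and [p 0 = 0] follow. *)
Definition sublinear p :=
  (forall x y, p (x + y) <= p x + p y) /\
  (forall t x, 0 < t -> p (t *_R x) <= t * p x).

Definition real_linear (u : V -> R) :=
  (forall x y, u (x + y) = u x + u y) /\
  (forall t x, u (t *_R x) = t * u x).

Lemma of_real1 : of_real s 1 = 1 :> scalar_field R s.
Proof. by case: s. Qed.

Lemma rscaler1 x : 1 *_R x = x.
Proof. by rewrite of_real1 scale1r. Qed.

Lemma rscalerN1 x : (-1) *_R x = - x.
Proof.
rewrite (_ : of_real s (-1) = -1) ?scaleN1r//.
by case: s => //=; rewrite rmorphN.
Qed.

Lemma rscaler0 x : 0 *_R x = 0.
Proof. by rewrite (_ : of_real s 0 = 0) ?scale0r//; case: s. Qed.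

Lemma rscalerA (a b : R) x : a *_R (b *_R x) = (a * b) *_R x.
Proof. by rewrite scalerA -of_realM. Qed.

Lemma rscalerBl (a b : R) x : (a - b) *_R x = a *_R x - b *_R x.
Proof. by rewrite of_realD scalerDl -(mulN1r b) -rscalerA rscalerN1. Qed.

Lemma sublinear0 p : sublinear p -> p 0 = 0.
Proof.
move=> [_ pM]; have h2 : (0 : R) < 2^-1 by lra.
have := pM 2 0 (ltr0Sn _ 1); have := pM 2^-1 0 h2; rewrite !scaler0; lra.
Qed.

Lemma sublinear_ge_opp p x : sublinear p -> - p (- x) <= p x.
Proof.
by move=> sp; have := sp.1 x (- x); rewrite subrr (sublinear0 sp); lra.
Qed.

Lemma odd_sublinear p :
  sublinear p -> (forall x, p (- x) <= - p x) -> real_linear p.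
Proof.
move=> sp pN.
have {}pN x : p (- x) = - p x.
  by apply/eqP; rewrite eq_le pN/=; have := sublinear_ge_opp x sp; lra.
have pM t x : 0 < t -> p (t *_R x) = t * p x.
  move=> t0; apply/eqP; rewrite eq_le sp.2//=.
  by have := sp.2 t (- x) t0; rewrite scalerN !pN mulrN lerN2.
split=> [x y|t x].
  apply/eqP; rewrite eq_le sp.1/=.
  by have := sp.1 (- x) (- y); rewrite -opprD !pN; lra.
have [t0|t0|->] := ltgtP t 0; last by rewrite rscaler0 mul0r sublinear0.
  have -> : t *_R x = - ((- t) *_R x).
    by rewrite -rscalerN1 rscalerA; congr (_ *_R _); ring.
  by rewrite pN pM; [ring|lra].
exact: pM.
Qed.

(** The functional is [p w = inf_(c in C) (q (w + c) - h c)]: it is finite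
    because [q (w + c) - h c >= q (w + c) - q c >= - q (- w)], and [c] itself is
    a competitor in [p (- c)].  A functional below [p] dominates [h] on the
    convex cone [C], which is how domination constraints are encoded. *)
Lemma inf_convolution q (C : set V) (h : V -> R) : sublinear q ->
  C 0 -> h 0 = 0 ->
  (forall c d, C c -> C d -> C (c + d) /\ h c + h d <= h (c + d)) ->
  (forall t c, 0 < t -> C c -> C (t *_R c) /\ t * h c <= h (t *_R c)) ->
  (forall c, C c -> h c <= q c) ->
  exists p, [/\ sublinear p, forall w, p w <= q w &
    forall c, C c -> p (- c) <= - h c].
Proof.
move=> sq C0 h0 CD CM hq.
pose E w := [set q (w + c) - h c | c in C].
have Elb w : lbound (E w) (- q (- w)).
  move=> _ [c Cc <-]; have := sq.1 (w + c) (- w); rewrite addrAC subrr add0r.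
  by have := hq _ Cc; lra.
have infE w c : C c -> inf (E w) <= q (w + c) - h c.
  by move=> Cc; apply: ge_inf; [exists (- q (- w))|exists c].
have Einf w r : (forall c, C c -> r <= q (w + c) - h c) -> r <= inf (E w).
  move=> rE; apply: lb_le_inf; first by exists (q (w + 0) - h 0), 0.
  by move=> _ [c Cc <-]; exact: rE.
exists (fun w => inf (E w)); split.
- split=> [x y|t x t0].
    rewrite -lerBlDr; apply: (Einf) => c Cc.
    rewrite lerBlDr -lerBlDl; apply: (Einf) => d Cd.
    have [Ccd hcd] := CD c d Cc Cd.
    have := infE (x + y) _ Ccd; have := sq.1 (x + c) (y + d).
    by rewrite addrACA; lra.
  rewrite -ler_pdivrMl//; apply: (Einf) => c Cc.
  have [Ctc htc] := CM t c t0 Cc.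
  rewrite ler_pdivrMl//; have := infE (t *_R x) _ Ctc.
  have := sq.2 t (x + c) t0; rewrite scalerDr mulrBr; lra.
- by move=> w; have := infE w 0 C0; rewrite addr0 h0 subr0.
- move=> c Cc; have := infE (- c) c Cc.
  by rewrite addNr (sublinear0 sq) sub0r.
Qed.

(** Zorn's lemma for the pointwise order: the pointwise infimum of a nonempty
    chain is finite since every [q <= p] satisfies [q x >= - p (- x)], and it is
    subadditive because any two members of the chain are comparable. *)
Lemma minimal_sublinear p : sublinear p -> exists q,
  [/\ sublinear q, forall x, q x <= p x &
    forall r, sublinear r -> (forall x, r x <= q x) -> r = q].
Proof.
move=> sp.
pose T := {q : V -> R | sublinear q /\ forall x, q x <= p x}.
pose le (q r : T) := `[< forall x, sval r x <= sval q x >].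
have [||||[q [sq qp]] qmin] := @Zorn T le.
- by move=> q; apply/asboolP => x.
- move=> q r t /asboolP rq /asboolP tr; apply/asboolP => x.
  exact: le_trans (tr x) (rq x).
- move=> [q hq] [r hr] /asboolP/= rq /asboolP/= qr; apply: eq_exist.
  by apply/funext => x; apply/eqP; rewrite eq_le qr rq.
- move=> A Atot; have [[q0 Aq0]|A0] := pselect (A !=set0); last first.
    by exists (exist _ p (conj sp (fun x => lexx (p x)))) => q /(ex_intro A q).
  pose E x := [set sval (q : T) x | q in A].
  have Elb x : has_lbound (E x).
    exists (- p (- x)) => _ [[q [sq qp]] Aq <-] /=.
    by have := sublinear_ge_opp x sq; have := qp (- x); lra.
  have infE x (q : T) : A q -> inf (E x) <= sval q x.
    by move=> Aq; apply: ge_inf => //; exists q.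
  have Einf x r : (forall q : T, A q -> r <= sval q x) -> r <= inf (E x).
    move=> rE; apply: lb_le_inf; first by exists (sval q0 x), q0.
    by move=> _ [q Aq <-]; exact: rE.
  have sE : sublinear (fun x => inf (E x)).
    split=> [x y|t x t0].
      rewrite -lerBlDr; apply: (Einf) => q Aq.
      rewrite lerBlDr -lerBlDl; apply: (Einf) => r Ar.
      have [/asboolP rq|/asboolP qr] := Atot _ _ Aq Ar.
        have := infE (x + y) r Ar; have := (svalP r).1.1 x y.
        by have := rq x; lra.
      have := infE (x + y) q Aq; have := (svalP q).1.1 x y.
      by have := qr y; lra.
    rewrite -ler_pdivrMl//; apply: (Einf) => q Aq; rewrite ler_pdivrMl//.
    exact: le_trans (infE _ _ Aq) ((svalP q).1.2 t x t0).
  have Ep x : inf (E x) <= p x.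
    exact: le_trans (infE x q0 Aq0) ((svalP q0).2 x).
  exists (exist _ (fun x => inf (E x)) (conj sE Ep)) => q Aq.
  by apply/asboolP => x; exact: infE.
exists q; split=> // r sr rq.
have rp x : r x <= p x by exact: le_trans (rq x) (qp x).
by apply: (congr1 sval (qmin (exist _ r (conj sr rp)) _)); apply/asboolP.
Qed.

(** A minimal sublinear [q] is odd: convolving it with itself along the ray
    spanned by [v] gives some [r <= q] with [r (- v) <= - q v], and minimality
    says that [r = q]. *)
Lemma real_linear_below_sublinear p : sublinear p ->
  exists u, real_linear u /\ forall x, u x <= p x.
Proof.
move=> sp; have [q [sq qp qmin]] := minimal_sublinear sp.
exists q; split=> //; apply: odd_sublinear => // v.
have qM t x : 0 < t -> q (t *_R x) = t * q x.
  move=> t0; apply/eqP; rewrite eq_le sq.2//= -ler_pdivlMl//.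
  have := sq.2 t^-1 (t *_R x); rewrite invr_gt0 => /(_ t0).
  by rewrite rscalerA mulVf ?rscaler1// gt_eqF.
pose C := [set t *_R v | t in [set t : R | 0 <= t]].
have qC t : 0 <= t -> q (t *_R v) = t * q v.
  rewrite le_eqVlt => /predU1P[<-|]; last exact: qM.
  by rewrite rscaler0 mul0r sublinear0.
have [||c d|t c t0||r [sr rq rC]] := @inf_convolution q C q sq.
- by exists 0 => //=; rewrite rscaler0.
- exact: sublinear0.
- move=> [a a0 <-] [b b0 <-]; rewrite -scalerDl -of_realD.
  have ab : 0 <= a + b by exact: addr_ge0.
  by split; [exists (a + b)|rewrite !qC// mulrDl].
- move=> [a a0 <-]; split; last by rewrite (qM _ _ t0).
  by exists (t * a); rewrite ?rscalerA//=; apply: mulr_ge0 => //; exact: ltW.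
- by [].
rewrite -{1}(qmin r sr rq); apply: rC; exists 1 => //=; last exact: rscaler1.
Qed.

End sublinear.

(** * Real parts, norms and functionals over either scalar field *)

Section scalar_parts.
Variables (R : realType) (s : scalars).
Local Notation K := (scalar_field R s).
Implicit Types (z w : K) (t : R).

Lemma reD z w : re (z + w) = re z + re w.
Proof. by case: s z w => //= z w; rewrite raddfD. Qed.

Lemma reN z : re (- z) = - re z.
Proof. by case: s z => //= z; rewrite raddfN. Qed.

Lemma re_realM t z : re (of_real s t * z) = t * re z.
Proof. by case: s z => //= -[a b] /=; rewrite mul0r subr0. Qed.

Lemma of_real_real t : of_real s t \is Num.real.
Proof. by case: s => //=; rewrite complex_real. Qed.

Lemma re_le_rnorm z : re z <= rnorm (z : K^o).
Proof.
rewrite /rnorm; case: s z => /= [z|[a b]]; first exact: ler_norm.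
rewrite /Normc.normc/=; apply: le_trans (ler_norm a) _.
by rewrite -sqrtr_sqr ler_sqrt ?lerDl ?sqr_ge0// addr_ge0 ?sqr_ge0.
Qed.

Lemma eq1_of_re z : rnorm (z : K^o) <= 1 -> re z = 1 -> z = 1.
Proof.
rewrite /rnorm; case: s z => //= -[a b]; rewrite /Normc.normc/= => h a1.
have : 1 + b ^+ 2 <= 1.
  rewrite -[leRHS](expr1n _ 2) -ler_sqrt ?expr1n ?sqrtr1//.
  by rewrite -[X in X + _](expr1n _ 2) -{1}a1.
rewrite gerDl => b0; have /eqP : b ^+ 2 = 0.
  by apply/eqP; rewrite eq_le b0 sqr_ge0.
by rewrite sqrf_eq0 a1 => /eqP ->.
Qed.

(** Rotating a scalar onto the positive half-line reduces bounds on absolute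
    values to bounds on real parts. *)
Lemma rotate_to_rnorm z :
  exists2 c : K, `|c| = 1 & c * z = of_real s (rnorm (z : K^o)).
Proof.
have [->|z0] := eqVneq z 0.
  by exists 1; rewrite ?normr1// mulr0 (@rnorm0 R s K^o); case: s.
exists (`|z| / z); last by rewrite divfK// (@re_normK R s K^o).
by rewrite normrM normfV normr_id divff// normr_eq0.
Qed.

Variable V : normedModType K.
Implicit Types x y : V.

Lemma rnormN x : rnorm (- x) = rnorm x.
Proof. by rewrite /rnorm normrN. Qed.

Lemma rnormBC x y : rnorm (x - y) = rnorm (y - x).
Proof. by rewrite -rnormN opprB. Qed.

Lemma rnormZ_real t x : rnorm (of_real s t *: x) = `|t| * rnorm x.
Proof.
rewrite rnormZ; congr (_ * _); rewrite /rnorm; case: s => //=.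
by rewrite /Normc.normc expr0n/= addr0 sqrtr_sqr.
Qed.

Lemma rnormZ1 (c : K) x : `|c| = 1 -> rnorm (c *: x) = rnorm x.
Proof.
move=> c1; rewrite rnormZ {1}/rnorm (_ : `|_| = 1 :> K)// -of_real1.
by rewrite of_realK mul1r.
Qed.

Lemma rnorm_eq0 x : rnorm x = 0 -> x = 0.
Proof.
move=> x0; apply/normr0_eq0; rewrite -(re_normK (s := s)) x0.
by case: s.
Qed.

Lemma rnorm_gt0 x : x != 0 -> 0 < rnorm x.
Proof.
by apply: contraNlt => x0; apply/eqP/rnorm_eq0/eqP; rewrite eq_le x0 rnorm_ge0.
Qed.

End scalar_parts.

Section dual_facts.
Variables (R : realType) (s : scalars) (X : normedModType (scalar_field R s)).
Local Notation K := (scalar_field R s).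
Implicit Types (x y : X) (f g : dual X).

Lemma rnorm_dualE f : rnorm f = dual_rnorm f.
Proof. by rewrite /rnorm [`|f|]/(dual_norm f) of_realK. Qed.

Lemma rnorm_le_of_re (g : X -> K^o) (M : R) : linear g ->
  (forall x, re (g x) <= M * rnorm x) -> forall x, rnorm (g x) <= M * rnorm x.
Proof.
move=> lg gM x; have [c c1 cE] := rotate_to_rnorm (g x).
have gc : g (c *: x) = c *: g x.
  have g0 : g 0 = 0.
    by have := lg (-1) 0 0; rewrite scaler0 add0r scaleN1r addNr.
  by have := lg c x 0; rewrite g0 !addr0.
have := gM (c *: x); rewrite gc [re _](_ : _ = rnorm (g x)); last first.
  by rewrite -[c *: _]/(c * _) cE of_realK.
by rewrite rnormZ1.
Qed.

Lemma rnorm_dual_le f x : rnorm (f x) <= rnorm f * rnorm x.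
Proof.
have [->|x0] := eqVneq x 0.
  by rewrite linear0 rnorm0 mulr0 (@rnorm0 R s K^o).
have rx := rnorm_gt0 x0.
have := @dual_rnorm_ub R s X f (of_real s (rnorm x)^-1 *: x).
rewrite rnormZ_real ger0_norm ?invr_ge0 ?(ltW rx)// mulVf ?gt_eqF//.
move=> /(_ (lexx _)); rewrite linearZ/= (@rnormZ_real R s K^o).
rewrite ger0_norm ?invr_ge0 ?(ltW rx)// mulrC ler_pdivrMr//.
by rewrite -rnorm_dualE.
Qed.

Lemma re_dual_le f x : re (f x) <= rnorm f * rnorm x.
Proof. exact: le_trans (re_le_rnorm (f x)) (rnorm_dual_le f x). Qed.

Lemma rnorm_dual_le_of_re f (M : R) :
  (forall x, rnorm x <= 1 -> re (f x) <= M) -> rnorm f <= M.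
Proof.
move=> fM; rewrite rnorm_dualE; apply: dual_rnorm_le => x x1.
have [c c1 cE] := rotate_to_rnorm (f x).
have := fM (c *: x); rewrite rnormZ1// => /(_ x1); rewrite linearZ/=.
by rewrite -[c *: _]/(c * _) cE of_realK.
Qed.

Lemma real_linear_re_dual f : real_linear (fun x => re (f x)).
Proof.
split=> [x y|t x]; first by rewrite linearD reD.
by rewrite linearZ re_realM.
Qed.

Lemma re_dualB f x y : re (f (x - y)) = re (f x) - re (f y).
Proof. by rewrite linearB reD reN. Qed.

(** A bound on the real part is enough for continuity. *)
Lemma linear_dual (g : X -> K^o) (M : R) : linear g ->
  (forall x, re (g x) <= M * rnorm x) -> exists f : dual X, forall x, f x = g x.
Proof.
move=> lg gM.
have gcl : g \in @continuous_linear R s X.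
  apply/asboolP; split=> //.
  pose gl : {linear X -> K^o} :=
    HB.pack g (GRing.isLinear.Build K X K^o *:%R g lg).
  apply: (linear_bounded_continuous gl).1; apply/linear_boundedP.
  near=> r => x; have rM : of_real s M <= r.
    by near: r; apply: nbhs_pinfty_ge; exact: of_real_real.
  apply: le_trans (ler_wpM2r (normr_ge0 x) rM).
  rewrite -!(@re_normK R s) -of_realM ler_of_real.
  exact: rnorm_le_of_re.
by exists (Dual gcl).
Unshelve. all: by end_near. Qed.

End dual_facts.

(** In the complex case the functional with real part [u] is
    [x |-> u x - i u (i x)]. *)
Lemma dual_of_real_linear (R : realType) (s : scalars)
    (X : normedModType (scalar_field R s)) (u : X -> R) (M : R) :
  real_linear u -> (forall x, u x <= M * rnorm x) ->
  exists f : dual X, forall x, re (f x) = u x.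
Proof.
case: s X u => X u [uD uM] uM'.
  have lu : linear (u : X -> R^o) by move=> a x y; rewrite uD uM.
  have [f fu] := @linear_dual R RealScalars X u M lu uM'.
  by exists f => x; rewrite fu.
pose g (x : X) : R[i]^o := (u x +i* - u ('i%C *: x))%C.
have lg : linear g.
  move=> [a b] x y; rewrite /g.
  have aE (z : X) : (a +i* b)%C *: z = a%:C%C *: z + b%:C%C *: ('i%C *: z).
    by rewrite scalerA -scalerDl; congr (_ *: _); simpc.
  rewrite scalerDr scalerA mulrC -scalerA !aE !uD !uM scalerA.
  have -> : ('i * 'i)%C = of_real ComplexScalars (-1) :> R[i].
    by rewrite /=; simpc.
  rewrite uM; apply/eqP; rewrite eq_complex /=.
  by apply/andP; split; apply/eqP => /=; ring.
have [f fg] := @linear_dual R ComplexScalars X g M lg uM'.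
by exists f => x; rewrite fg.
Qed.

(** * Ekeland's principle and norm-attaining functionals *)

Section complete.
Variables (R : realType) (s : scalars).
Variable X : completeNormedModType (scalar_field R s).
Local Notation K := (scalar_field R s).
Implicit Types (x y z : X) (f g : dual X).

Lemma gt0_of_real (e : K) : 0 < e -> exists2 r : R, 0 < r & e = of_real s r.
Proof.
move=> e0; exists (rnorm (e : K^o)).
  by apply: (@rnorm_gt0 R s K^o); rewrite gt_eqF.
by rewrite (@re_normK R s K^o) gtr0_norm.
Qed.

Lemma cauchy_rnorm_cvg (x : nat -> X) :
  (forall e : R, 0 < e ->
     exists N, forall n, (N <= n)%N -> rnorm (x n - x N) < e) ->
  exists y, forall e : R, 0 < e ->
     exists N, forall n, (N <= n)%N -> rnorm (y - x n) < e.
Proof.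
move=> xC.
have ltK (v : X) (e : R) : (`|v| < of_real s e) = (rnorm v < e).
  by rewrite -(re_normK v) !lt_def ler_of_real (can_eq (@of_realK R s)).
have : cauchy (x @ \oo).
  apply: cauchy_exP => _ /gt0_of_real[e e0 ->].
  have [N xN] := xC e e0; exists (x N), N => // n Nn.
  by rewrite -ball_normE /= distrC ltK; exact: xN.
move=> /cauchy_cvg/cvg_ex[y xy]; exists y => e e0.
have e0' : 0 < of_real s e.
  have -> : (0 : K) = of_real s 0 by case: (s).
  by rewrite lt_def ler_of_real (can_eq (@of_realK R s)) -lt_def.
move/cvgrPdist_lt : xy => /(_ _ e0')[N _ yN]; exists N => n Nn.
by rewrite -ltK; exact: yN.
Qed.

(** Order [C] by letting [z] dominate [x] when [phi] gains at least
    [k * rnorm (z - x)] from [x] to [z].  A sequence in which each term almost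
    maximizes [phi] over the elements dominating the previous one is Cauchy,
    since [phi] is bounded on [C], and nothing above its limit can have a larger
    value of [phi].  The third hypothesis is closedness of [C]. *)
Lemma ekeland (C : set X) (phi : X -> R) (L B k : R) x0 : 0 < k -> 0 <= L ->
  (forall y,
    (forall e : R, 0 < e -> exists2 z, C z & rnorm (y - z) < e) -> C y) ->
  (forall x y, phi x - phi y <= L * rnorm (x - y)) ->
  (forall x, C x -> phi x <= B) -> C x0 ->
  exists y, [/\ C y, k * rnorm (y - x0) <= phi y - phi x0 &
    forall z, C z -> phi z <= phi y + k * rnorm (z - y)].
Proof.
move=> k0 L0 Ccl phiL phiB Cx0.
pose S x z := C z /\ k * rnorm (z - x) <= phi z - phi x.
have Strans x y z : S x y -> S y z -> S x z.
  move=> [Cy xy] [Cz yz]; split=> //.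
  have := ler_wpM2l (ltW k0) (ler_rnormD (z - y) (y - x)).
  rewrite (addrA (z - y)) subrK; lra.
have Srefl x : C x -> S x x.
  by move=> Cx; split=> //; rewrite !subrr rnorm0 mulr0.
(* [nx (n, x)] dominates [x] and is maximal up to [1 / (n + 1)]. *)
have /choice[nx nxP] (p : nat * X) : exists z, C p.2 ->
    S p.2 z /\ forall w, S p.2 w -> phi w <= phi z + p.1.+1%:R^-1.
  case: p => n x /=.
  have [Cx|nCx] := pselect (C x); last by exists x.
  have sE : has_sup [set phi z | z in S x].
    split; first by exists (phi x), x => //; exact: Srefl.
    by exists B => _ [z [Cz _] <-]; exact: phiB.
  have n0 : 0 < n.+1%:R^-1 :> R by rewrite invr_gt0 ltr0Sn.
  have [_ [z Sz <-] zE] := sup_adherent n0 sE; exists z => _; split=> // w Sw.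
  have := ub_le_sup sE.2 (_ : [set phi z | z in S x] (phi w)).
  move=> /(_ (ex_intro2 _ _ w Sw erefl))/le_trans; apply.
  by rewrite -lerBlDr ltW.
pose xs := fix xs n := if n is m.+1 then nx (m, xs m) else x0.
have Cxs n : C (xs n).
  by elim: n => //= n IH; have [[]] := nxP (n, xs n) IH.
have Sxs m n : (m <= n)%N -> S (xs m) (xs n).
  move=> /subnKC <-; elim: (n - m)%N => [|j IH].
    by rewrite addn0; exact: Srefl.
  rewrite addnS; apply: (Strans _ _ _ IH).
  by have [] := nxP ((m + j)%N, xs (m + j)%N) (Cxs (m + j)%N).
have [|y xsy] := @cauchy_rnorm_cvg xs.
  move=> e e0.
  have sE : has_sup (range (phi \o xs)).
    by split; [exists (phi (xs 0)), 0|exists B => _ [n _ <-]; exact: phiB].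
  have [_ [N _ <-] /= NE] := sup_adherent (mulr_gt0 k0 e0) sE.
  exists N => n /Sxs[_ Nn].
  have := ub_le_sup sE.2 (_ : range (phi \o xs) (phi (xs n))).
  move=> /(_ (ex_intro2 _ _ n I erefl)) nE.
  rewrite -(ltr_pM2l k0); lra.
have Cy : C y.
  by apply: Ccl => e /xsy[N yN]; exists (xs N) => //; exact: yN.
have Sy n : S (xs n) y.
  split=> //; apply/ler_addgt0Pr => e e0.
  have kL : 0 < k + L by lra.
  have [N yN] := xsy _ (divr_gt0 e0 kL).
  have := yN _ (leq_maxl N n); set m := maxn N n => ym.
  have [_ nm] := Sxs _ _ (leq_maxr N n).
  have h1 := ler_wpM2l (ltW k0) (ler_rnormD (y - xs m) (xs m - xs n)).
  have h2 := phiL (xs m) y; rewrite rnormBC in h2.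
  rewrite (addrA (y - _)) subrK mulrDr in h1.
  have : (k + L) * rnorm (y - xs m) <= e.
    by rewrite mulrC -ler_pdivlMr// ltW.
  by rewrite -/m in nm; lra.
exists y; split=> //; first exact: (Sy 0%N).2.
move=> z Cz; rewrite leNgt; apply/negP => zy.
have zn n : phi z <= phi y + n.+1%:R^-1.
  have Sz : S (xs n) z by apply: (Strans _ _ _ (Sy n)); split=> //; lra.
  have /= := (nxP (n, xs n) (Cxs n)).2 z Sz; have /= := (Sy n.+1).2.
  set e := _^-1.
  have := mulr_ge0 (ltW k0) (rnorm_ge0 (y - nx (n, xs n))); lra.
have /ltr_add_invr[n] : phi y < phi z.
  have := mulr_ge0 (ltW k0) (rnorm_ge0 (z - y)); lra.
by rewrite ltNge zn.
Qed.

(** At the point [y] provided by Ekeland's principle for [re \o f] on the unit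
    ball, [re (f c) <= k * rnorm c] for every direction [c] pointing into the
    ball.  Hahn-Banach then gives [U] with [rnorm U <= k] and [re f <= re U] on
    these directions, so that [re (f - U)] is maximal over the ball at [y]. *)
Lemma bishop_phelps f x (k d : R) :
  0 < k -> rnorm x <= 1 -> rnorm f <= re (f x) + d ->
  exists y g, [/\ rnorm y <= 1, re (g y) = rnorm g, rnorm (x - y) <= d / k &
    rnorm (f - g) <= k].
Proof.
move=> k0 x1 fx.
have f0 := rnorm_ge0 f.
have phiL (a b : X) : re (f a) - re (f b) <= rnorm f * rnorm (a - b).
  by rewrite -re_dualB; exact: re_dual_le.
have ball_closed (y : X) :
    (forall e : R, 0 < e ->
      exists2 z, closed_unit_ball X z & rnorm (y - z) < e) ->
    closed_unit_ball X y.
  move=> yC; apply/ler_addgt0Pr => e /yC[z z1 yz].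
  have := ler_rnormD (y - z) z; rewrite subrK.
  by have : rnorm z <= 1 by []; lra.
have fB a : closed_unit_ball X a -> re (f a) <= rnorm f.
  by move=> a1; apply: le_trans (re_dual_le f a) _; apply: ler_piMr.
have [y [y1 xy ymax]] := ekeland k0 f0 ball_closed phiL fB x1.
have fy := fB _ y1.
pose q (w : X) := k * rnorm w.
have sq : sublinear q.
  split=> [a b|t a t0]; first by rewrite /q -mulrDr ler_wpM2l ?ler_rnormD// ltW.
  by rewrite /q rnormZ_real gtr0_norm// mulrCA.
(* The cone of directions pointing from [y] into the unit ball. *)
pose C :=
  [set c : X | exists2 t : R, 0 < t & rnorm (y + of_real s t *: c) <= 1].
have [fD fM] := real_linear_re_dual f.
have [||a b|t a t0|a|p [sp pq pC]] :=
  @inf_convolution R s X q C (fun x => re (f x)) sq.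
- by exists 1 => //; rewrite scaler0 addr0.
- by rewrite -(@rscaler0 R s X 0) fM mul0r.
- move=> [t t0 ta] [r r0 rb]; split; last by rewrite fD.
  have tr0 : 0 < t + r by lra.
  exists (t * r / (t + r)); first by rewrite divr_gt0// mulr_gt0.
  have w1 : 0 <= r / (t + r) by rewrite ltW ?divr_gt0.
  have w2 : 0 <= t / (t + r) by rewrite ltW ?divr_gt0.
  have wE : r / (t + r) + t / (t + r) = 1 by field; rewrite gt_eqF.
  (* With the step [t r / (t + r)], [y + step (a + b)] is a convex combination
     of the points [y + t a] and [y + r b] of the ball. *)
  have -> : y + of_real s (t * r / (t + r)) *: (a + b) =
      of_real s (r / (t + r)) *: (y + of_real s t *: a) +
      of_real s (t / (t + r)) *: (y + of_real s r *: b).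
    rewrite !scalerDr !rscalerA addrACA -scalerDl -of_realD wE rscaler1.
    by congr (_ + (of_real s _ *: _ + of_real s _ *: _)); ring.
  apply: le_trans (ler_rnormD _ _) _.
  rewrite !rnormZ_real (ger0_norm w1) (ger0_norm w2) -wE.
  by apply: lerD; exact: ler_piMr.
- move=> [r r0 ra]; split; last by rewrite fM.
  exists (r / t); first exact: divr_gt0.
  by rewrite rscalerA divfK// gt_eqF.
- move=> [t t0 ta]; have := ymax _ ta; rewrite fD fM addrAC subrr add0r.
  rewrite lerD2l rnormZ_real gtr0_norm// mulrCA ler_pM2l//.
have [u [ul up]] := real_linear_below_sublinear sp.
have uk w : u w <= k * rnorm w by exact: le_trans (up w) (pq w).
have [U Uu] := dual_of_real_linear ul uk.
exists y, (f - U).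
have gB z : rnorm z <= 1 -> re ((f - U) z) <= re ((f - U) y).
  move=> z1; have Cz : C (z - y).
    by exists 1 => //; rewrite rscaler1 addrC subrK.
  have := le_trans (up _) (pC _ Cz); rewrite -Uu opprB !re_dualB.
  rewrite -![(f - U) _]/(f _ - U _) !reD !reN; lra.
split=> //.
- apply/eqP; rewrite eq_le; apply/andP; split.
    by apply: le_trans (re_dual_le _ y) _; rewrite ler_piMr ?rnorm_ge0.
  exact: rnorm_dual_le_of_re.
- by rewrite ler_pdivlMr// mulrC rnormBC; lra.
- rewrite opprB addrCA subrr addr0; apply: rnorm_dual_le_of_re => w w1.
  by rewrite Uu; apply: le_trans (uk w) _; rewrite ler_piMr// ltW.
Qed.

End complete.

(** * Uniform non-squareness *)

Section nonsquareness.
Variables (R : realType) (s : scalars).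
Local Notation K := (scalar_field R s).
Local Notation "t *_R x" := (of_real s t *: x) (at level 40).

Lemma alpha_has_sup (V : normedModType K) :
  has_sup [set 2^-1 * (rnorm (x + y) + rnorm (x - y)) |
    x in closed_unit_ball V & y in closed_unit_ball V].
Proof.
have B0 : closed_unit_ball V 0 by rewrite /closed_unit_ball/= rnorm0.
split.
  exists (2^-1 * (rnorm (0 + 0 : V) + rnorm (0 - 0 : V))).
  by exists 0 => //; exists 0.
exists 2 => _ [x x1 [y y1 <-]].
have x1' : rnorm x <= 1 by [].
have y1' : rnorm y <= 1 by [].
by have := ler_rnormD x y; have := ler_rnormD x (- y); rewrite rnormN; lra.
Qed.

Lemma alpha_nonsquare (V : normedModType K) (u v : V) :
  rnorm u <= 1 -> rnorm v <= 1 ->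
  rnorm (u + v) + rnorm (u - v) <= 2 * (2 - alpha V).
Proof.
move=> u1 v1; have [_ Eb] := alpha_has_sup V; have := ub_le_sup Eb.
move=> /(_ (2^-1 * (rnorm (u + v) + rnorm (u - v)))) H.
rewrite /alpha opprB addrCA subrr addr0 -ler_pdivrMl//; apply: H.
by exists u => //; exists v.
Qed.

Lemma alpha_ge (V : normedModType K) (a : R) :
  (forall u v : V, rnorm u <= 1 -> rnorm v <= 1 ->
    rnorm (u + v) + rnorm (u - v) <= 2 * (2 - a)) -> a <= alpha V.
Proof.
move=> h; rewrite /alpha lerBrDr addrC -lerBrDr.
apply: ge_sup; first by have [] := alpha_has_sup V.
by move=> _ [x x1 [y y1 <-]]; rewrite ler_pdivrMl//; exact: h.
Qed.

Lemma alpha_ge0 (V : normedModType K) : 0 <= alpha V.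
Proof.
apply: alpha_ge => u v u1 v1.
by have := ler_rnormD u v; have := ler_rnormD u (- v); rewrite rnormN; lra.
Qed.

Lemma alpha_le2 (V : normedModType K) : alpha V <= 2.
Proof.
have := @alpha_nonsquare V 0 0; rewrite rnorm0 => /(_ ler01 ler01).
by have := rnorm_ge0 (0 + 0 : V); have := rnorm_ge0 (0 - 0 : V); lra.
Qed.

(** If [f + g] and [f - g] nearly attain their norms at [x] and [y], then
    [|f + g| + |f - g|] is nearly the real part of
    [(f + g) x + (f - g) y = f (x + y) + g (x - y)], which is at most
    [|x + y| + |x - y|]. *)
Lemma alpha_le_dual (X : normedModType K) : alpha X <= alpha (dual X).
Proof.
apply: alpha_ge => f g f1 g1; rewrite -lerBrDr.
apply: rnorm_dual_le_of_re => x x1; rewrite lerBrDr addrC -lerBrDr.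
apply: rnorm_dual_le_of_re => y y1.
rewrite -[(f + g) x]/(f x + g x) -[(f - g) y]/(f y - g y) !reD reN.
have := alpha_nonsquare x1 y1.
have := le_trans (re_dual_le f (x + y)) (ler_piMl (rnorm_ge0 _) f1).
have := le_trans (re_dual_le g (x - y)) (ler_piMl (rnorm_ge0 _) g1).
rewrite re_dualB linearD reD; lra.
Qed.

(** With [P], [M] the norms of the sum and the difference of two vectors of the
    ball, the hypotheses give
    [k D <= k^2 + (2 - 2 a) r k - r^2 <= (1 + (1 - a)^2) k^2], and
    [1 + (1 - a)^2 <= 2 - 2 a / 3] whenever [0 <= a <= 4 / 3]. *)
Lemma nonsquare_tradeoff (a k r P M D : R) : 0 < k -> 0 <= a -> a <= 1 ->
  P + M <= 2 * (2 - a) -> 0 <= r -> r <= k ->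
  r + k <= k * P -> D <= r * M + (k - r) -> D <= (2 - 2 * a / 3) * k.
Proof.
move=> k0 a0 a1 PM r0 rk kP DM; rewrite -(ler_pM2l k0).
have kM : k * M <= k * (2 * (2 - a)) - (r + k).
  by have := ler_wpM2l (ltW k0) PM; rewrite mulrDr; lra.
have rkM := ler_wpM2l r0 kM.
have kD := ler_wpM2l (ltW k0) DM.
have sq := sqr_ge0 (k * (1 - a) - r).
have ak : 0 <= a * (4 / 3 - a) * k ^+ 2.
  by rewrite !mulr_ge0 ?sqr_ge0//; lra.
nra.
Qed.

(** Let [u = (z - t y) / k].  If [t <= 1], then
    [z = k (u + y) + (t - k) y] forces [|u + y|] to be large while
    [z - y = (1 - t) (u - y) + (k - (1 - t)) u] is long only if [|u - y|] is
    large.  If [t > 1], the same happens with [z] in place of [y], from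
    [t y = k (z - u) + (1 - k) z] and
    [t (z - y) = (t - 1) (z + u) + (k - (t - 1)) u].  The condition
    [k <= 1/2] makes [t - k] nonnegative. *)
Lemma dist_normalized_le (V : normedModType K) (a k t : R) (z y : V) :
  (forall u v : V, rnorm u <= 1 -> rnorm v <= 1 ->
    rnorm (u + v) + rnorm (u - v) <= 2 * (2 - a)) ->
  0 <= a -> 0 < k -> k <= 2^-1 -> rnorm z = 1 -> rnorm y = 1 ->
  rnorm (z - t *_R y) <= k -> 0 < t -> rnorm (z - y) <= (2 - 2 * a / 3) * k.
Proof.
move=> ha a0 k0 k2 z1 y1 zty t0.
have a1 : a <= 1.
  (* The pair [z], [- z] bounds the parameter by one. *)
  have := ha z (- z); rewrite rnormN z1 opprK => /(_ (lexx 1) (lexx 1)).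
  rewrite subrr rnorm0 add0r.
  have -> : z + z = 2 *_R z by rewrite -[2]/(1 + 1) of_realD scalerDl rscaler1.
  by rewrite rnormZ_real z1 ger0_norm; lra.
pose u := k^-1 *_R (z - t *_R y).
have kz : z = k *_R u + t *_R y.
  by rewrite /u rscalerA divff ?gt_eqF// rscaler1 subrK.
have u1 : rnorm u <= 1.
  by rewrite /u rnormZ_real gtr0_norm ?invr_gt0// ler_pdivrMl// mulr1.
have tri (b c : R) (v w : V) : 0 <= b -> 0 <= c ->
    rnorm (b *_R v + c *_R w) <= b * rnorm v + c * rnorm w.
  move=> b0 c0; apply: le_trans (ler_rnormD _ _) _.
  by rewrite !rnormZ_real !ger0_norm.
have t_le : t <= 1 + k.
  have := ler_rnormD z (t *_R y - z).
  by rewrite addrC subrK rnormZ_real gtr0_norm// z1 y1 rnormBC; lra.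
have t_ge : 1 - k <= t.
  have := ler_rnormD (z - t *_R y) (t *_R y).
  by rewrite subrK rnormZ_real gtr0_norm// z1 y1; lra.
have [tle1|tgt1] := lerP t 1.
- apply: (@nonsquare_tradeoff a k (1 - t) (rnorm (u + y)) (rnorm (u - y)))
    => //; try lra.
  + by apply: ha; rewrite ?y1.
  + have := tri k (t - k) (u + y) y.
    have -> : k *_R (u + y) + (t - k) *_R y = z.
      by rewrite scalerDr -addrA -scalerDl -of_realD subrKC -kz.
    by rewrite z1 y1 => /(_ (ltW k0)); lra.
  + have := tri (1 - t) (k - (1 - t)) (u - y) u.
    have -> : (1 - t) *_R (u - y) + (k - (1 - t)) *_R u = z - y.
      rewrite scalerDr addrAC -scalerDl -of_realD subrKC [in RHS]kz -addrA.
      by congr (_ + _); rewrite scalerN rscalerBl rscaler1 opprB.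
    have := ler_wpM2l (_ : 0 <= k - (1 - t)) u1; lra.
- have ty : t *_R y = z - k *_R u by rewrite {1}kz addrC addKr.
  apply: (@nonsquare_tradeoff a k (t - 1) (rnorm (z - u)) (rnorm (z + u)))
    => //; try lra.
  + by rewrite addrC; apply: ha; rewrite ?z1.
  + have := tri k (1 - k) (z - u) z.
    have -> : k *_R (z - u) + (1 - k) *_R z = t *_R y.
      by rewrite ty scalerBr rscalerBl rscaler1 addrC addrA subrK.
    by rewrite rnormZ_real gtr0_norm// z1 y1 => /(_ (ltW k0)); lra.
  + have := tri (t - 1) (k - (t - 1)) (z + u) u.
    have -> : (t - 1) *_R (z + u) + (k - (t - 1)) *_R u = t *_R (z - y).
      rewrite scalerDr (rscalerBl k) -addrA subrKC.
      by rewrite rscalerBl rscaler1 scalerBr ty opprB addrA addrAC.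
    rewrite rnormZ_real gtr0_norm//.
    have := ler_wpM2l (_ : 0 <= k - (t - 1)) u1.
    have := ler_peMl (rnorm_ge0 (z - y)) (ltW tgt1); lra.
Qed.
End nonsquareness.

(** * The spherical Bishop-Phelps-Bollobas modulus *)

Lemma bishop_phelps_bollobas (R : realType) (s : scalars)
    (X : completeNormedModType (scalar_field R s)) (a d k : R) (x : X)
    (f : dual X) :
  0 <= a -> a <= alpha (dual X) -> 0 < k -> k <= 2^-1 ->
  rnorm x = 1 -> rnorm f = 1 -> 1 - d < re (f x) ->
  exists y g, [/\ Pi X (y, g), rnorm (x - y) <= d / k &
    rnorm (f - g) <= (2 - 2 * a / 3) * k].
Proof.
move=> a0 aa k0 k2 x1 f1 fx.
have [||y [g [y1 gy xy fg]]] := @bishop_phelps R s X f x k d k0.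
  by rewrite x1.
  by rewrite f1; lra.
have g0 : 0 < rnorm g.
  by have := ler_rnormD (f - g) g; rewrite subrK f1; lra.
have {}y1 : rnorm y = 1.
  apply/eqP; rewrite eq_le y1/= -(ler_pM2l g0) mulr1 -{1}gy.
  exact: re_dual_le.
pose h := of_real s (rnorm g)^-1 *: g.
have h1 : rnorm h = 1.
  by rewrite /h rnormZ_real gtr0_norm ?invr_gt0// mulVf ?gt_eqF.
have gh : g = of_real s (rnorm g) *: h.
  by rewrite /h rscalerA divff ?rscaler1// gt_eqF.
have hy : h y = 1.
  apply: eq1_of_re.
    by apply: le_trans (rnorm_dual_le h y) _; rewrite h1 y1 mulr1.
  change (re (of_real s (rnorm g)^-1 * g y) = 1).
  by rewrite re_realM gy mulVf ?gt_eqF.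
exists y, h; split=> //.
apply: (@dist_normalized_le R s (dual X) a k (rnorm g)) => //.
  move=> u v u1 v1; apply: le_trans (alpha_nonsquare u1 v1) _.
  by rewrite ler_wpM2l// lerD2l lerN2.
by rewrite -gh.
Qed.

Lemma Phi_S_le (R : realType) (s : scalars)
    (X : completeNormedModType (scalar_field R s)) (a d k e : R) :
  0 <= a -> a <= alpha (dual X) -> 0 < k -> k <= 2^-1 ->
  d / k <= e -> (2 - 2 * a / 3) * k <= e -> (Phi_S X d <= e%:E)%E.
Proof.
move=> a0 aa k0 k2 dke ake; apply/lee_addgt0Pr => r r0.
apply: ereal_inf_lbound; exists (e + r) => //; split=> [|x f x1 f1 fx].
  have a2 := le_trans aa (alpha_le2 (dual X)); clear aa.
  have : 0 <= (2 - 2 * a / 3) * k by rewrite mulr_ge0 ?ltW//; lra.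
  lra.
have [y [g [yg xy fg]]] := bishop_phelps_bollobas a0 aa k0 k2 x1 f1 fx.
by exists y, g; split=> //; lra.
Qed.

Lemma Phi_S_sqrt_le (R : realType) (s : scalars)
    (X : completeNormedModType (scalar_field R s)) (a d : R) :
  0 <= a -> a <= alpha (dual X) -> 0 < d -> d < 2^-1 - a / 6 ->
  (Phi_S X d <= (Num.sqrt (2 * d) * Num.sqrt (1 - a / 3))%:E)%E.
Proof.
move=> a0 aa d0 d1; have a2 := le_trans aa (alpha_le2 (dual X)).
set e := _ * _.
have e0 : 0 < e by rewrite mulr_gt0// sqrtr_gt0; lra.
have eE : e * e = d * (2 - 2 * a / 3).
  by rewrite -expr2 exprMn !sqr_sqrtr; lra.
have k2 : d / e <= 2^-1.
  rewrite ler_pdivrMr//.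
  have : (2 * d) * (2 * d) <= e * e by rewrite eE; nra.
  rewrite -!expr2 ler_sqr ?nnegrE; lra.
(* For [e = sqrt (d (2 - 2 a / 3))] the step [d / e] makes both bounds equal
   to [e]. *)
apply: (@Phi_S_le R s X a d (d / e)) => //; first exact: divr_gt0.
  by rewrite invf_div mulrC divfK// gt_eqF.
by rewrite mulrA mulrC [_ * d]mulrC -eE mulKf// gt_eqF.
Qed.

Lemma Phi_S_linear_le (R : realType) (s : scalars)
    (X : completeNormedModType (scalar_field R s)) (a d : R) :
  0 <= a -> a <= alpha (dual X) -> 2^-1 - a / 6 < d ->
  (Phi_S X d <= (2 * d)%:E)%E.
Proof.
move=> a0 aa d1; apply: (@Phi_S_le R s X a d 2^-1) => //; lra.
Qed.

Theorem theorem3p3 (R : realType) (s : scalars)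
    (X : completeNormedModType (scalar_field R s)) :
  (forall a : R, 0 < a -> a < alpha (dual X) ->
    (forall d : R, 0 < d -> d < 2^-1 - a / 6 ->
      (Phi_S X d <= (Num.sqrt (2 * d) * Num.sqrt (1 - a / 3))%:E)%E) /\
    (forall d : R, 2^-1 - a / 6 < d -> d < 2^-1 ->
      (Phi_S X d <= (2 * d)%:E)%E)) /\
  (forall d : R, 0 < d -> d < 2^-1 - alpha X / 6 ->
    (Phi_S X d <= (Num.sqrt (2 * d) * Num.sqrt (1 - alpha X / 3))%:E)%E) /\
  (forall d : R, 2^-1 - alpha X / 6 < d -> d < 2^-1 ->
    (Phi_S X d <= (2 * d)%:E)%E).
Proof.
have bounds (a : R) : 0 <= a -> a <= alpha (dual X) ->
    (forall d : R, 0 < d -> d < 2^-1 - a / 6 ->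
      (Phi_S X d <= (Num.sqrt (2 * d) * Num.sqrt (1 - a / 3))%:E)%E) /\
    (forall d : R, 2^-1 - a / 6 < d -> d < 2^-1 ->
      (Phi_S X d <= (2 * d)%:E)%E).
  move=> a0 aa; split=> d d1 d2; first exact: Phi_S_sqrt_le.
  exact: Phi_S_linear_le d1.
split=> [a a0 aa|]; first by apply: bounds; exact: ltW.
exact: bounds (alpha_ge0 X) (alpha_le_dual X).
Qed.
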